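(* Let $(X,\langle\cdot|\cdot\rangle)$ be an infinite-dimensional complex Hilbert space and $A:D(A)\to X$ a densely-defined, linear and self-adjoint operator with a purely discrete spectrum $\sigma(A)$. Let $(e_k)_{k\in\mathbb{N}^*}$ be a Hilbert basis of $X$ consisting of eigenvectors of $A$, with corresponding eigenvalues $(\lambda_k)_{k\in\mathbb{N}^*}$, so that $\sigma(A)=\{\lambda_k:k\in\mathbb{N}^*\}$. Let $f:\sigma(A)\to\mathbb{R}$ be bounded. (i) Then $f(A)$ is self-adjoint with pure point spectrum, and its spectrum is $$\sigma(f(A))=\overline{\{f(\lambda_k):k\in\mathbb{N}^*\}} .$$ (ii) If $g:\sigma(f(A))\to\mathbb{C}$ is bounded, then $$g(f(A))=(g\circ f)(A).$$
   Context: $\mathbb{N}^*=\{1,2,\dots\}$. ''Purely discrete spectrum'' means that $\sigma(A)$ is discrete and contains only eigenvalues of finite multiplicity. An operator has pure point spectrum if there is a Hilbert basis (complete orthonormal system) of eigenvectors of it. For a self-adjoint operator $T$ with pure point spectrum and a bounded function $h:\sigma(T)\to\mathbb{C}$, $h(T)$ denotes the bounded operator given by the functional calculus (spectral theorem); it satisfies $h(T)\xi=h(\mu)\xi$ for every eigenvector $\xi$ of $T$ with eigenvalue $\mu$, and these relations determine it. In particular $f(A)\xi=\sum_{k=1}^\infty f(\lambda_k)\langle e_k|\xi\rangle e_k$ for $\xi \in X$. *)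

(* Defs.v *)
From HB Require Import structures.
From mathcomp Require Import all_boot all_order all_algebra.
From mathcomp Require Import sesquilinear complex.
From mathcomp Require Import boolp classical_sets functions reals topology.
From mathcomp Require Import normedtype.

Set Implicit Arguments.
Unset Strict Implicit.
Unset Printing Implicit Defensive.

Import Order.TTheory GRing.Theory Num.Theory.
Import numFieldNormedType.Exports.

Local Open Scope classical_set_scope.
Local Open Scope ring_scope.
Local Open Scope complex_scope.

HB.mixin Record isHilbert (R : realType) X of CompleteNormedModule R[i] X := {
  dotp : {dot X for @Num.conj R[i]};
  sqr_normE : forall x : X, `|x| ^+ 2 = dotp x x
}.

#[short(type="hilbertType")]
HB.structure Definition Hilbert (R : realType) :=
  {X of isHilbert R X & CompleteNormedModule R[i] X}.

(* Forms {dot _ for _} are linear in their first argument; [inner] is linear in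
   the second one and conjugate-linear in the first. *)
Definition inner (R : realType) (X : hilbertType R) (x y : X) : R[i] :=
  dotp y x.

Section Subspaces.
Variables (R : realType) (X : hilbertType R).
Implicit Types S : set X.

Definition span (I : Type) (e : I -> X) : set X :=
  [set x | exists n (c : 'I_n -> R[i]) (s : 'I_n -> I),
     x = \sum_(j < n) c j *: e (s j)].

Definition finite_dimensional S :=
  exists n (v : 'I_n -> X), S `<=` span v.

Definition hilbert_basis (I : Type) (e : I -> X) :=
  [/\ forall i, inner (e i) (e i) = 1,
      forall i j, i <> j -> inner (e i) (e j) = 0
    & dense (span e)].

End Subspaces.

Section Operators.
Variables (R : realType) (X : hilbertType R).

(* The values of [app] outside of [dom] are irrelevant. *)
Record operator := Operator {
  dom : set X;
  app :> X -> X;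
  dom0 : dom 0;
  dom_linear : forall (a : R[i]) x y, dom x -> dom y -> dom (a *: x + y);
  app_linear : forall (a : R[i]) x y, dom x -> dom y ->
    app (a *: x + y) = a *: app x + app y }.

Record bounded_operator := BoundedOperator {
  bapp :> {linear X -> X};
  bappP : exists M : R[i], forall x, `|bapp x| <= M * `|x| }.

Definition everywhere (B : bounded_operator) : operator :=
  @Operator setT B I (fun _ _ _ _ _ => I) (fun a x y _ _ => linearP B a x y).

Coercion everywhere : bounded_operator >-> operator.

Definition graph (T : operator) : set (X * X) :=
  [set p | dom T p.1 /\ T p.1 = p.2].

Definition adjoint_graph (T : operator) : set (X * X) :=
  [set p | forall x, dom T x -> inner p.1 (T x) = inner p.2 x].

Definition densely_defined (T : operator) := dense (dom T).

Definition self_adjoint (T : operator) :=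
  densely_defined T /\ graph T = adjoint_graph T.

Definition resolvent_set (T : operator) : set R[i]^o :=
  [set z | exists B : bounded_operator,
     (forall x, dom T (B x) /\ T (B x) - z *: B x = x) /\
     (forall x, dom T x -> B (T x - z *: x) = x)].

Definition spectrum (T : operator) : set R[i]^o := ~` resolvent_set T.

Definition eigenspace (T : operator) (z : R[i]) : set X :=
  [set x | dom T x /\ T x = z *: x].

Definition eigenvector (T : operator) (z : R[i]) (x : X) :=
  x != 0 /\ eigenspace T z x.

Definition eigenvalue (T : operator) (z : R[i]) :=
  exists x, eigenvector T z x.

Definition purely_discrete_spectrum (T : operator) :=
  spectrum T `<=` isolated (spectrum T) /\
  forall z, spectrum T z -> eigenvalue T z /\ finite_dimensional (eigenspace T z).

Definition pure_point_spectrum (T : operator) :=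
  exists (I : Type) (e : I -> X), hilbert_basis e /\
    forall i, exists z, eigenvector T z (e i).

Lemma zero_bounded : exists M : R[i], forall x : X, `|(\0 : X -> X) x| <= M * `|x|.
Proof. by exists 0 => x; rewrite /= normr0 mul0r. Qed.

Definition zero_operator : bounded_operator := BoundedOperator zero_bounded.

(* For T self-adjoint with pure point spectrum and h bounded on the spectrum of T,
   exactly one bounded operator satisfies [is_fcalc T h], and it is h(T); only the
   values of h on the spectrum matter. [fcalc T h] is h(T) in that case, and 0
   when no operator satisfies [is_fcalc T h]. *)
Definition is_fcalc (T : operator) (h : R[i] -> R[i]) (B : bounded_operator) :=
  forall z x, eigenvector T z x -> B x = h z *: x.

Definition fcalc (T : operator) (h : R[i] -> R[i]) : bounded_operator :=
  if pselect (exists B, is_fcalc T h B) is left ex_B then projT1 (cid ex_B)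
  else zero_operator.

End Operators.

(* Main.v *)
(** Everything is diagonal in the basis [e]. For bounded [c], the partial sums of
    [\sum_k c_k <e_k|x> e_k] are bounded by [sup |c_k|] (Bessel) and are eventually
    constant for [x] in the span of [e], so they converge for every [x] to a bounded
    operator. An eigenvector of a self-adjoint operator with eigenvectors [e_k] is
    orthogonal to the [e_k] of any other eigenvalue, so the diagonal operator with
    entries [h (lambda_k)] is [h(A)]. In particular [f(A)] is diagonal with real
    entries [c_k := f (lambda_k)]; its resolvent at [z] is diagonal with entries
    [1 / (c_k - z)], which is bounded exactly when [z] is away from the closure of the
    [c_k]; and [g(f(A))] and [(g o f)(A)] have the same diagonal entries. *)

Require Import Defs.
From HB Require Import structures.
From mathcomp Require Import all_boot all_order all_algebra.
From mathcomp Require Import sesquilinear complex.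
From mathcomp Require Import boolp classical_sets functions reals topology.
From mathcomp Require Import normedtype.
From mathcomp Require Import ring.

Set Implicit Arguments.
Unset Strict Implicit.
Unset Printing Implicit Defensive.

Import Order.TTheory GRing.Theory Num.Theory.
Import numFieldNormedType.Exports.

Local Open Scope classical_set_scope.
Local Open Scope ring_scope.
Local Open Scope complex_scope.

(** * Inner product: sesquilinearity, Pythagoras, Cauchy-Schwarz *)

Section InnerProduct.
Context {R : realType} {X : hilbertType R}.
Implicit Types (x y z : X) (a : R[i]).

Lemma inner_linear x : linear (inner x : X -> R[i]^o).
Proof. by move=> a y z; rewrite /inner linearPl. Qed.

Lemma innerDr x y z : inner x (y + z) = inner x y + inner x z.
Proof. by rewrite /inner linearDl. Qed.

Lemma innerBr x y z : inner x (y - z) = inner x y - inner x z.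
Proof. by rewrite /inner linearBl. Qed.

Lemma innerZr x a y : inner x (a *: y) = a * inner x y.
Proof. by rewrite /inner linearZl_LR. Qed.

Lemma inner_sumr x (I : Type) (r : seq I) (F : I -> X) :
  inner x (\sum_(i <- r) F i) = \sum_(i <- r) inner x (F i).
Proof. by rewrite /inner linear_sumlz. Qed.

Lemma innerC x y : inner x y = ((inner y x)^*)%R.
Proof. by rewrite /inner hermC expr0 mul1r. Qed.

Lemma innerBl x y z : inner (x - y) z = inner x z - inner y z.
Proof. by rewrite /inner linearBr. Qed.

Lemma innerZl x a y : inner (a *: x) y = (a^*)%R * inner x y.
Proof. by rewrite /inner linearZr_LR. Qed.

Lemma inner_normE x : inner x x = `|x| ^+ 2.
Proof. by rewrite sqr_normE. Qed.

Lemma inner_eq0 x : inner x x = 0 -> x = 0.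
Proof. by rewrite inner_normE => /eqP; rewrite sqrf_eq0 normr_eq0 => /eqP. Qed.

Lemma sqr_normDd x y : inner x y = 0 -> `|x + y| ^+ 2 = `|x| ^+ 2 + `|y| ^+ 2.
Proof.
move=> xy0; rewrite !sqr_normE hnormDd//.
by have := innerC y x; rewrite xy0 conjC0.
Qed.

(** Cauchy-Schwarz: split [y] into its projection [a *: x] and an orthogonal remainder, and drop the
    remainder from Pythagoras. *)
Lemma norm_inner_le x y : `|inner x y| <= `|x| * `|y|.
Proof.
have [->|x0] := eqVneq x 0.
  by rewrite /inner linear0r !normr0 mul0r.
set a := inner x y / `|x| ^+ 2.
have nx0 : `|x| ^+ 2 != 0 by rewrite sqrf_eq0 normr_eq0.
have orth : inner (a *: x) (y - a *: x) = 0.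
  by rewrite innerZl innerBr innerZr inner_normE divfK// subrr mulr0.
rewrite -(@ler_pXn2r _ 2)// ?nnegrE ?mulr_ge0// exprMn.
have -> : `|y| ^+ 2 = `|a *: x| ^+ 2 + `|y - a *: x| ^+ 2.
  by rewrite -sqr_normDd// addrC subrK.
rewrite mulrDr ler_wpDr ?mulr_ge0 ?exprn_ge0//.
rewrite normrZ exprMn normrM normfV !exprMn exprVn (ger0_norm (exprn_ge0 _ _))//.
rewrite le_eqVlt; apply/orP; left; apply/eqP.
by field; rewrite normr_eq0.
Qed.

End InnerProduct.

(** * Bounded linear maps *)

Lemma linear_comb (K : nzRingType) (V W : lmodType K) (phi : V -> W) n
    (a : 'I_n -> K) (v : 'I_n -> V) : linear phi ->
  phi (\sum_(j < n) a j *: v j) = \sum_(j < n) a j *: phi (v j).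
Proof.
move=> lphi; pose L : {linear V -> W} := HB.pack phi
  (GRing.isLinear.Build K V W *:%R phi lphi).
apply: (etrans (linear_sum L _ _ _)); apply: eq_bigr => j _; exact: (linearZ_LR L).
Qed.

Section BoundedLinear.
Context {R : realType} {X : hilbertType R}.

Definition bounded_linear {V W : normedModType R[i]} (phi : V -> W) :=
  linear phi /\ exists M : R[i], forall x, `|phi x| <= M * `|x|.

(** A strictly positive bound can be divided by. The given [M] is an arbitrary complex number, hence
    the choice of [|M| + 1]. *)
Lemma bounded_linear_gt0 {V W : normedModType R[i]} (phi : V -> W) :
  bounded_linear phi -> exists2 M : R[i], 0 < M & forall x, `|phi x| <= M * `|x|.
Proof.
move=> [_ [M phiM]]; exists (`|M| + 1); first by rewrite ltr_wpDl.
move=> x; apply: (le_trans (phiM x)).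
have /ger0_norm <- : 0 <= M * `|x| by apply: le_trans (phiM x).
by rewrite normrM normr_id ler_wpM2r// lerDl.
Qed.

Lemma bounded_linear_comp {U V W : normedModType R[i]} (phi : V -> W) (psi : U -> V) :
  bounded_linear phi -> bounded_linear psi -> bounded_linear (phi \o psi).
Proof.
move=> bphi bpsi; split.
  by move=> a x y /=; rewrite bpsi.1 bphi.1.
have [M M0 phiM] := bounded_linear_gt0 bphi.
have [N N0 psiN] := bounded_linear_gt0 bpsi.
exists (M * N) => x /=; apply: (le_trans (phiM _)).
by rewrite -mulrA ler_pM2l.
Qed.

Lemma bounded_linearB {V W : normedModType R[i]} (phi psi : V -> W) :
  bounded_linear phi -> bounded_linear psi ->
  bounded_linear (fun x => phi x - psi x).
Proof.
move=> bphi bpsi; split.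
  by move=> a x y; rewrite bpsi.1 bphi.1 scalerBr opprD addrACA.
have [M M0 phiM] := bounded_linear_gt0 bphi.
have [N N0 psiN] := bounded_linear_gt0 bpsi.
exists (M + N) => x; apply: (le_trans (ler_normB _ _)).
by rewrite mulrDl lerD.
Qed.

Lemma bounded_linearZ {V : normedModType R[i]} (a : R[i]) :
  bounded_linear (fun x : V => a *: x).
Proof.
split; first by move=> b x y; rewrite scalerDr !scalerA mulrC.
by exists `|a| => x; rewrite normrZ.
Qed.

Lemma bounded_linear_bapp (B : bounded_operator X) : bounded_linear (bapp B).
Proof. by split; [exact: linearP|exact: bappP]. Qed.

Lemma bounded_linear_inner (x : X) : bounded_linear (inner x : X -> R[i]^o).
Proof.
split; first exact: inner_linear.
by exists `|x| => y; exact: norm_inner_le.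
Qed.

End BoundedLinear.

(** * Hilbert bases: density of the span and Bessel's inequality *)

Section Basis.
Context {R : realType} {X : hilbertType R} {e : nat -> X}.
Hypothesis basis_e : hilbert_basis e.

Lemma inner_basis i j : inner (e i) (e j) = (i == j)%:R.
Proof.
case: basis_e => e1 e0 _; case: eqVneq => [->|/eqP ij]; first exact: e1.
exact: e0.
Qed.

Lemma basis_approx x (eps : R[i]) : 0 < eps -> exists2 y, Defs.span e y & `|x - y| < eps.
Proof.
case: basis_e => _ _ de eps0.
have [] := de (ball x eps) _ (ball_open x eps).
  by exists x; exact: ballxx.
by move=> y [xy ey]; exists y => //; move: xy; rewrite -ball_normE.
Qed.

(** The difference is bounded and vanishes on the dense span. Later identities are reduced to basis
    vectors this way. *)
Lemma bounded_linear_ext {W : normedModType R[i]} (phi psi : X -> W) :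
  bounded_linear phi -> bounded_linear psi ->
  (forall k, phi (e k) = psi (e k)) -> phi =1 psi.
Proof.
move=> bphi bpsi phi_psi x; apply/eqP; rewrite -subr_eq0 -normr_eq0.
have b := bounded_linearB bphi bpsi.
have [M M0 bM] := bounded_linear_gt0 b.
apply/negPn/negP => d0.
have dpos : 0 < `|phi x - psi x| by rewrite lt_def d0 normr_ge0.
(* With [y] this close, the difference at [x] has norm at most [M * |x - y|], which is less than
   itself. *)
have [y [n [c [s ->]]] xy] := basis_approx x (divr_gt0 dpos M0).
have phi_psi_y : phi (\sum_(j < n) c j *: e (s j)) = psi (\sum_(j < n) c j *: e (s j)).
  rewrite (linear_comb _ _ bphi.1) (linear_comb _ _ bpsi.1).
  by apply: eq_bigr => j _; rewrite phi_psi.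
move: xy; rewrite ltr_pdivlMr// mulrC => /(le_lt_trans (bM _)).
rewrite (zmod_morphism_linear bphi.1) (zmod_morphism_linear bpsi.1) phi_psi_y.
by rewrite opprB addrA subrK ltxx.
Qed.

Lemma basis_inner_eq0 x : (forall k, inner (e k) x = 0) -> x = 0.
Proof.
move=> ex0; apply: inner_eq0.
(* The functional [inner x] vanishes on the basis, hence at [x] itself. *)
apply: (@bounded_linear_ext R[i]^o (inner x) (fun=> 0)).
- exact: bounded_linear_inner.
- split; first by move=> a u v; rewrite scaler0 addr0.
  by exists 0 => u; rewrite normr0 mul0r.
- by move=> k; rewrite innerC ex0 conjC0.
Qed.

Lemma sqr_norm_basis_sum n (a : nat -> R[i]) :
  `|\sum_(k < n) a k *: e k| ^+ 2 = \sum_(k < n) `|a k| ^+ 2.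
Proof.
elim: n => [|n IHn]; first by rewrite !big_ord0 normr0 expr0n.
rewrite !big_ord_recr/= addrC sqr_normDd ?IHn.
  by rewrite addrC normrZ exprMn -(inner_normE (e n)) inner_basis eqxx mulr1.
rewrite inner_sumr big1// => k _; rewrite innerZl innerZr inner_basis.
by rewrite gtn_eqF ?mulr0//.
Qed.

(** The sum is the squared norm of the projection [p] of [x], and [x - p] is orthogonal to [p]. *)
Lemma bessel n x : \sum_(k < n) `|inner (e k) x| ^+ 2 <= `|x| ^+ 2.
Proof.
set p := \sum_(k < n) inner (e k) x *: e k.
have -> : \sum_(k < n) `|inner (e k) x| ^+ 2 = `|p| ^+ 2.
  by rewrite (@sqr_norm_basis_sum n (fun k => inner (e k) x)).
suff px : inner (x - p) p = 0.
  by rewrite -[in leRHS](subrK p x) sqr_normDd// lerDr exprn_ge0.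
rewrite {2}/p inner_sumr big1// => k _; rewrite innerZr (innerC (x - p)) innerBr.
rewrite /p inner_sumr (bigD1 k)//= big1 ?addr0 => [|j /negPf jk].
  by rewrite innerZr inner_basis eqxx mulr1 subrr conjC0 mulr0.
by rewrite innerZr inner_basis eq_sym (jk : (j == k :> nat) = false) mulr0.
Qed.

(** * Construction of the diagonal operator with bounded entries *)

Section Diagonal.
Variables (c : nat -> R[i]) (M : R[i]).
Hypothesis cM : forall k, `|c k| <= M.

Let S n x := \sum_(k < n) (c k * inner (e k) x) *: e k.

Let S_linear n : linear (S n).
Proof.
move=> a x y; rewrite /S scaler_sumr -big_split/=; apply: eq_bigr => k _.
by rewrite innerDr innerZr mulrDr scalerDl scalerA mulrCA.
Qed.

Let M_ge0 : 0 <= M.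
Proof. exact: le_trans (cM 0). Qed.

Let normS n x : `|S n x| <= M * `|x|.
Proof.
rewrite -(@ler_pXn2r _ 2)// ?nnegrE ?mulr_ge0//.
rewrite (sqr_norm_basis_sum n (fun k => c k * inner (e k) x)) exprMn.
apply: (@le_trans _ _ (M ^+ 2 * \sum_(k < n) `|inner (e k) x| ^+ 2)).
  rewrite mulr_sumr; apply: ler_sum => k _; rewrite normrM exprMn.
  by rewrite ler_wpM2r ?exprn_ge0// ler_pXn2r ?nnegrE.
by rewrite ler_wpM2l ?exprn_ge0// bessel.
Qed.

Let S_basis n k : (k < n)%N -> S n (e k) = c k *: e k.
Proof.
move=> kn; rewrite /S (bigD1 (Ordinal kn))//= big1 ?addr0 => [|j /negPf jk].
  by rewrite inner_basis eqxx mulr1.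
by rewrite inner_basis (jk : (j == k :> nat) = false) mulr0 scale0r.
Qed.

Let S_span y : Defs.span e y -> exists N, forall n, (N <= n)%N -> S n y = S N y.
Proof.
(* Beyond this rank the partial sum contains every index of the combination; the successor is there
   because [S n] stops at [n - 1]. *)
move=> [m [a [s ->]]]; exists (\max_(j < m) (s j).+1).
have SE n : (\max_(j < m) (s j).+1 <= n)%N ->
    S n (\sum_(j < m) a j *: e (s j)) = \sum_(j < m) a j *: (c (s j) *: e (s j)).
  move=> Nn; rewrite (linear_comb _ _ (S_linear n)); apply: eq_bigr => j _.
  by rewrite S_basis//; apply: leq_trans Nn; exact: (@leq_bigmax _ (fun j => (s j).+1)).
by move=> n Nn; rewrite !SE.
Qed.

Let S_cvg x : cvg (S ^~ x @ \oo).
Proof.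
apply/cauchy_cvgP/cauchy_exP => eps eps0.
(* [M] may be 0, so the radius of approximation is [eps / (M + 1)]. *)
have M1 : 0 < M + 1 by rewrite ltr_wpDl.
have [y /S_span[N SN] xy] := basis_approx x (divr_gt0 eps0 M1).
exists (S N y); exists N => // n /= Nn; rewrite -ball_normE/= -(SN n Nn).
have -> : S n y - S n x = S n (y - x).
  by rewrite (zmod_morphism_linear (S_linear n)).
apply: (le_lt_trans (normS _ _)); rewrite distrC.
apply: (@le_lt_trans _ _ ((M + 1) * `|x - y|)).
  by rewrite ler_wpM2r// lerDl.
by rewrite mulrC -ltr_pdivlMr.
Qed.

Let D x : X := lim (S ^~ x @ \oo).

Let D_linear : linear D.
Proof.
move=> a x y; apply: cvg_lim; first exact: norm_hausdorff.
under eq_fun do rewrite S_linear.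
by apply: cvgD; [apply: cvgZr|]; exact: S_cvg.
Qed.

Let norm_D x : `|D x| <= M * `|x|.
Proof.
(* The order on [R[i]] is partial: negating an inequality requires both sides to be real. *)
have r1 : M * `|x| \is Num.real by rewrite ger0_real// mulr_ge0.
have r2 : `|D x| \is Num.real by exact: normr_real.
rewrite real_leNgt//; apply/negP => lt_D.
have Dx : S ^~ x @ \oo --> D x by exact: S_cvg.
have /cvgrPdist_lt/(_ (`|D x| - M * `|x|)) := Dx.
rewrite subr_gt0 => /(_ lt_D)[N _ /(_ N (leqnn N))/=].
apply/negP; rewrite -real_leNgt// ?rpredB ?normr_real//.
apply: le_trans (lerB_dist _ _).
by rewrite lerB.
Qed.

Lemma diagonal_operator : exists B : bounded_operator X,
  forall k, bapp B (e k) = c k *: e k.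
Proof.
pose Dl := GRing.isLinear.Build R[i] X X *:%R D D_linear.
pose L : {linear X -> X} := HB.pack D Dl.
have LM : exists N : R[i], forall x, `|L x| <= N * `|x| by exists M.
exists (BoundedOperator LM) => k /=.
apply: cvg_lim; first exact: norm_hausdorff.
by apply: cvg_near_cst; exists k.+1 => // n /= /S_basis.
Qed.

End Diagonal.

(** * Self-adjointness and spectrum of diagonal operators *)

Section DiagonalOperator.
Variables (B : bounded_operator X) (c : nat -> R[i]).
Hypothesis Be : forall k, bapp B (e k) = c k *: e k.

Lemma basis_neq0 k : e k != 0.
Proof.
apply/eqP => ek0; have := inner_basis k k.
by rewrite ek0 eqxx inner_normE normr0 expr0n => /eqP; rewrite eq_sym oner_eq0.
Qed.

Lemma diagonal_eigenvector k : eigenvector B (c k) (e k).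
Proof. by split; [exact: basis_neq0|split=> //; exact: Be]. Qed.

Let bounded_linear_inner_comp u : bounded_linear (inner u \o bapp B : X -> R[i]^o).
Proof.
exact: bounded_linear_comp (bounded_linear_inner _) (bounded_linear_bapp _).
Qed.

Lemma diagonal_inner k x : inner (e k) (bapp B x) = c k * inner (e k) x.
Proof.
apply: (bounded_linear_ext (bounded_linear_inner_comp (e k)) (bounded_linear_comp
  (bounded_linearZ (V := R[i]^o) (c k)) (bounded_linear_inner (e k)))).
move=> j /=; rewrite Be innerZr inner_basis.
by have [->//|kj] := eqVneq k j; rewrite [LHS]mulr0 [RHS]mulr0.
Qed.

Lemma diagonal_self_adjoint : (forall k, (c k)^*%R = c k) -> self_adjoint B.
Proof.
move=> c_real.
have B_sym x y : inner x (bapp B y) = inner (bapp B x) y.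
  apply: (bounded_linear_ext (bounded_linear_inner_comp x) (bounded_linear_inner (bapp B x))).
  by move=> k /=; rewrite Be innerZr [RHS]innerC diagonal_inner rmorphM/= c_real -innerC.
split; first by move=> O [x Ox] _; exists x.
apply/seteqP; split => [[u v] [_ /= <-] y _|[u v] uv].
  exact: B_sym.
(* For [(u, v)] in the adjoint graph, symmetry makes [B u - v] orthogonal to every vector, in
   particular to itself. *)
split => //=; apply/eqP; rewrite -subr_eq0; apply/eqP/inner_eq0.
by rewrite {1}innerBl -B_sym (uv _ I) subrr.
Qed.

Lemma diagonal_spectrum : spectrum B = closure (range (c : nat -> R[i]^o)).
Proof.
apply/seteqP; split => z.
  apply: contra_notP => nclz.
  (* [eps] is the radius of a ball around [z] that misses every [c k]. *)
  have [eps eps0 ceps] :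
      exists2 eps : R[i], 0 < eps & forall k, eps <= `|c k - z|.
    move: nclz => /existsNP[U /not_implyP[/nbhs_ballP[eps /= eps0 zU] UE]].
    exists eps => // j; rewrite real_leNgt ?normr_real//; last exact: gtr0_real.
    apply/negP => cj_eps; apply: UE; exists (c j); split; first by exists j.
    by apply: zU; rewrite -ball_normE/= distrC.
  have cz0 k : c k - z != 0.
    by rewrite -normr_gt0; apply: lt_le_trans (ceps k).
  have [|D De] := @diagonal_operator (fun k => (c k - z)^-1) eps^-1.
    by move=> k; rewrite normfV lef_pV2// posrE// normr_gt0.
  have bB := bounded_linear_bapp B; have bD := bounded_linear_bapp D.
  have bid : bounded_linear (@id X).
    by split=> //; exists 1 => x; rewrite mul1r.
  have bBz := bounded_linearB bB (bounded_linearZ (V := X) z).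
  exists D; split=> [x|x _].
    split=> //.
    apply: (bounded_linear_ext (bounded_linear_comp bBz bD) bid) => k /=.
    by rewrite De linearZ/= Be !scalerA mulrC -scalerBl -mulrBl mulfV ?scale1r.
  apply: (bounded_linear_ext (bounded_linear_comp bD bBz) bid) => k /=.
  by rewrite Be -scalerBl linearZ/= De scalerA mulfV ?scale1r.
(* Conversely, a resolvent [D] bounded by [M] sends [(c k - z) *: e k] to [e k], forcing
   [|c k - z| >= M^-1] for all [k]. *)
move=> clz [D [_ DB]].
have [M M0 DM] := bounded_linear_gt0 (bounded_linear_bapp D).
have Minv : 0 < M^-1 by rewrite invr_gt0.
have [_ [[k _ <-]]] := clz _ (nbhsx_ballx (z : R[i]^o) _ Minv).
rewrite -ball_normE/= distrC; apply/negP.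
have := DB (e k) I; rewrite /= Be -scalerBl linearZ/= => Dek.
have : `|e k| <= `|c k - z| * (M * `|e k|).
  by rewrite -{1}Dek normrZ ler_wpM2l.
rewrite mulrA -{1}(mul1r `|e k|) ler_pM2r ?normr_gt0 ?basis_neq0//.
by rewrite -ler_pdivrMr// div1r => /le_gtF ->.
Qed.

End DiagonalOperator.
End Basis.

(** * Eigenvectors of self-adjoint operators and the functional calculus *)

Section FunctionalCalculus.
Context {R : realType} {X : hilbertType R}.
Implicit Types T : operator X.

Lemma self_adjoint_sym T x y : self_adjoint T -> dom T x -> dom T y ->
  inner x (T y) = inner (T x) y.
Proof.
move=> [_ gT] dx dy; have : graph T (x, T x) by [].
by rewrite gT => /(_ y dy).
Qed.

Lemma eigenvalue_spectrum T z x : eigenvector T z x -> spectrum T z.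
Proof.
move=> [x0 [dx Tx]] [B [_ /(_ x dx)]].
by rewrite Tx subrr linear0 => x0E; rewrite -x0E eqxx in x0.
Qed.

Lemma eigenvalue_unique T z z' x x' : self_adjoint T ->
  eigenvector T z x -> eigenvector T z' x' -> inner x x' != 0 -> z = z'.
Proof.
move=> saT [x0 [dx Tx]] [_ [dx' Tx']] xx'.
(* Symmetry applied to [x] with itself shows that [z] is real; applied to [x] and [x'] it then
   compares [z] with [z']. *)
have /(mulIf _) z_real : z * inner x x = z^*%R * inner x x.
  by rewrite -innerZr -Tx self_adjoint_sym// Tx innerZl.
apply: (mulIf xx').
by rewrite -(innerZr x z') -Tx' self_adjoint_sym// Tx innerZl -z_real//
  inner_normE sqrf_eq0 normr_eq0.
Qed.

Lemma fcalcP T h : (exists B, is_fcalc T h B) -> is_fcalc T h (fcalc T h).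
Proof. by rewrite /fcalc; case: pselect => // exB _; exact: projT2 (cid exB). Qed.

(** The diagonal operator with entries [h (mu k)] satisfies [is_fcalc T h], so [fcalc] does not fall
    back to its default 0. *)
Lemma fcalc_basis T (e : nat -> X) (mu : nat -> R[i]) (h : R[i] -> R[i]) (M : R[i]) :
  self_adjoint T -> hilbert_basis e -> (forall k, eigenvector T (mu k) (e k)) ->
  (forall k, `|h (mu k)| <= M) ->
  forall k, bapp (fcalc T h) (e k) = h (mu k) *: e k.
Proof.
move=> saT basis_e eig_e hM k; apply: fcalcP (eig_e k).
have [B Be] := diagonal_operator basis_e (c := h \o mu) hM.
exists B => z x zx; apply/eqP; rewrite -subr_eq0; apply/eqP.
apply: (basis_inner_eq0 basis_e) => j.
rewrite innerBr innerZr (diagonal_inner basis_e Be)/= -mulrBl.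
(* Either the coefficient of [x] along [e j] is 0, or [mu j] equals the eigenvalue of [x]. *)
have [->|xj0] := eqVneq (inner (e j) x) 0; first by rewrite mulr0.
by rewrite (eigenvalue_unique saT (eig_e j) zx xj0) subrr mul0r.
Qed.

End FunctionalCalculus.

Theorem theorem8 (R : realType) (X : hilbertType R)
    (infinite_dimX : ~ finite_dimensional [set: X])
    (A : operator X) (saA : self_adjoint A) (pdA : purely_discrete_spectrum A)
    (e : nat -> X) (lambda : nat -> R[i]) (basis_e : hilbert_basis e)
    (eig_e : forall k, eigenvector A (lambda k) (e k))
    (f : R[i] -> R) (bounded_f : [bounded f z | z in spectrum A]) :
  let fC : R[i] -> R[i] := fun z => (f z)%:C in
  let fA : operator X := fcalc A fC in
  [/\ self_adjoint fA,
      pure_point_spectrum fA,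
      spectrum fA = closure (range (fun k => fC (lambda k) : R[i]^o))
    & forall g : R[i] -> R[i],
        [bounded (g z : R[i]^o) | z in spectrum fA] ->
        forall x : X, fcalc fA g x = fcalc A (g \o fC) x].
Proof.
move=> fC fA.
have [M _ fM] := ex_strict_bound_gt0 bounded_f.
have fA_e : forall k, bapp (fcalc A fC) (e k) = fC (lambda k) *: e k.
  apply: (@fcalc_basis _ _ A e lambda fC M%:C) => // k.
  rewrite normc_def/= expr0n addr0 sqrtr_sqr lecR ltW//.
  exact: fM (eigenvalue_spectrum (eig_e k)).
have sa_fA : self_adjoint fA.
  by apply: (diagonal_self_adjoint basis_e fA_e) => k; exact: conjc_real.
have eig_fA := diagonal_eigenvector basis_e fA_e.
split=> //.
- by exists nat, e; split=> // k; exists (fC (lambda k)); exact: eig_fA.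
- exact: (diagonal_spectrum basis_e fA_e).
move=> g bounded_g.
have [N _ gN] := ex_strict_bound_gt0 bounded_g.
apply: (bounded_linear_ext basis_e (bounded_linear_bapp _) (bounded_linear_bapp _)) => k.
(* Each [fC (lambda j)] is an eigenvalue of [fA], so the bound on [g] applies there; it serves both
   calculi. *)
have gN_fA j : `|g (fC (lambda j))| <= N.
  by rewrite ltW//; exact: gN (eigenvalue_spectrum (eig_fA j)).
rewrite (fcalc_basis sa_fA basis_e eig_fA gN_fA).
by rewrite (fcalc_basis (h := g \o fC) saA basis_e eig_e gN_fA).
Qed.
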